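(* Let $m$ be a Carmichael number such that $L_m = 2^{\alpha}P^2$ for some positive integer $\alpha$ and some odd prime $P$. Suppose that $m$ is divisible by at least one of the known Fermat primes $3, 5, 17, 257, 65537$, and that every prime factor of $m$ of the form $2^k+1$ ($k\ge 1$) belongs to $\{3,5,17,257,65537\}$. Then $m$ is one of the following 11 Carmichael numbers (listed with the corresponding value $L=L_m$): \begin{enumerate} \item $3\cdot 11\cdot 17\cdot 401\cdot 641\cdot 1601$, with $L=2^7\cdot 5^2$; \item $5\cdot 7\cdot 17\cdot 19\cdot 73$, with $L=2^4\cdot 3^2$; \item $5\cdot 7\cdot 19\cdot 73\cdot 97\cdot 257$, with $L=2^8\cdot 3^2$; \item $5\cdot 13\cdot 257\cdot 577\cdot 1153$, with $L=2^8\cdot 3^2$; \item $5\cdot 37\cdot 73\cdot 257\cdot 577\cdot 769$, with $L=2^8\cdot 3^2$; \item $5\cdot 37\cdot 73\cdot 193\cdot 257\cdot 1153$, with $L=2^8\cdot 3^2$; \item $5\cdot 13\cdot 257\cdot 577\cdot 1153\cdot 18433$, with $L=2^{11}\cdot 3^2$; \item $5\cdot 257\cdot 37\cdot 73\cdot 577\cdot 12289\cdot 18433$, with $L=2^{12}\cdot 3^2$; \item $5\cdot 7\cdot 13\cdot 19\cdot 37\cdot 73\cdot 193\cdot 257\cdot 577\cdot 1153$, with $L=2^8\cdot 3^2$; \item $5\cdot 7\cdot 13\cdot 19\cdot 37\cdot 73\cdot 257\cdot 577\cdot 769\cdot 1153$, with $L=2^8\cdot 3^2$; \item $5\cdot 7\cdot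 19\cdot 73\cdot 97\cdot 193\cdot 577\cdot 769\cdot 12289\cdot 147457\cdot 65537\cdot 1179649\cdot 786433$, with $L=2^{18}\cdot 3^2$. \end{enumerate} In particular, $P$ is either $5$ or $3$.
   Context: A Carmichael number is a composite positive integer $m$ with $a^m\equiv a \pmod m$ for all integers $a$; equivalently (Korselt) a squarefree composite $m$ such that $p-1\mid m-1$ for every prime $p\mid m$. For a squarefree composite $m=p_1\cdots p_n$ (prime factorization), $L=L_m$ denotes the least common multiple of $p_1-1,\dots,p_n-1$.
   Formalization: Entry 10 is corrected by removing the factor 577, to 5·7·13·19·37·73·257·769·1153: the printed product is 65 mod 256, so it is not Carmichael, while the corrected number is Carmichael with L=2^8·3^2, meets all hypotheses and is missing from the printed list. *)

(* Defs.v *)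
From Stdlib Require Import BinNat.
From mathcomp Require Import all_boot all_order all_algebra.

Set Implicit Arguments.
Unset Strict Implicit.
Unset Printing Implicit Defensive.

Definition composite (m : nat) : bool := (1 < m) && ~~ prime m.

Definition carmichael (m : nat) : Prop :=
  composite m /\ forall a : int, ((a ^+ m)%R = a %[mod m])%Z.

(* [primes m] has no repetitions, so this is lcm (p_1 - 1, ..., p_n - 1) when
   m = p_1 ... p_n is squarefree, as every Carmichael number is. *)
Definition carmichael_L (m : nat) : nat := \big[lcmn/1]_(p <- primes m) p.-1.

(* Concrete primes are written in binary ([N]) and injected into [nat] by
   [nat_of_bin], because a large [nat] literal would be expanded in unary. *)
Definition known_fermat_primes : seq nat :=
  [seq nat_of_bin q | q <- [:: 3; 5; 17; 257; 65537]%num].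

Definition prodN (s : seq N) : nat := \prod_(p <- s) nat_of_bin p.

(* Pairs (m, L_m). In the entry 5 * 7 * 13 * 19 * 37 * 73 * 257 * 769 * 1153 the
   source prints an additional factor 577. That is a misprint: with it the
   product is 577 modulo 2^8 * 3^2, hence not a Carmichael number, whereas
   without it the product is 1 modulo 2^8 * 3^2. *)
Definition carmichael_list : seq (nat * nat) :=
  [:: (prodN [:: 3; 11; 17; 401; 641; 1601]%num, 2 ^ 7 * 5 ^ 2);
      (prodN [:: 5; 7; 17; 19; 73]%num, 2 ^ 4 * 3 ^ 2);
      (prodN [:: 5; 7; 19; 73; 97; 257]%num, 2 ^ 8 * 3 ^ 2);
      (prodN [:: 5; 13; 257; 577; 1153]%num, 2 ^ 8 * 3 ^ 2);
      (prodN [:: 5; 37; 73; 257; 577; 769]%num, 2 ^ 8 * 3 ^ 2);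
      (prodN [:: 5; 37; 73; 193; 257; 1153]%num, 2 ^ 8 * 3 ^ 2);
      (prodN [:: 5; 13; 257; 577; 1153; 18433]%num, 2 ^ 11 * 3 ^ 2);
      (prodN [:: 5; 257; 37; 73; 577; 12289; 18433]%num, 2 ^ 12 * 3 ^ 2);
      (prodN [:: 5; 7; 13; 19; 37; 73; 193; 257; 577; 1153]%num,
        2 ^ 8 * 3 ^ 2);
      (prodN [:: 5; 7; 13; 19; 37; 73; 257; 769; 1153]%num, 2 ^ 8 * 3 ^ 2);
      (prodN [:: 5; 7; 19; 73; 97; 193; 577; 769; 12289; 147457; 65537;
                 1179649; 786433]%num, 2 ^ 18 * 3 ^ 2)].

(* Main.v *)
From Stdlib Require Import BinNat.
Require Import Defs.
From mathcomp Require Import all_boot all_order all_algebra.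
From mathcomp Require Import all_fingroup all_solvable all_field zify.

(** The number [m] is odd, squarefree and [1] modulo [L = 2 ^ alpha * P ^ 2],
    and each of its primes is [2 ^ k * P ^ j + 1] with [1 <= k <= alpha] and
    [j <= 2]. Two congruences then leave finitely many possibilities.

    Modulo [P], every prime of [m] other than a Fermat prime is [1]. Let [S] be
    the set of Fermat primes dividing [m], a nonempty subset of
    [{3, 5, 17, 257, 65537}]. The product of [S] is [1] modulo [P], so [P]
    divides one of 31 known positive integers, the numbers [\prod S - 1]; this
    gives a finite list of primes [P] ([mem_candidate_primes]).

    Modulo powers of [2], say that a prime [p] of [m] has level [k] when [2 ^ k]
    is the exact power of [2] dividing [p - 1]. The only candidates of level [k]
    are [2 ^ k + 1], [2 ^ k * P + 1] and [2 ^ k * P ^ 2 + 1]. The primes of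
    level above [k] are [1] modulo [2 ^ (k + 1)], so for [k < alpha] the primes
    of level at most [k] have a product that is [1] modulo [2 ^ (k + 1)]. Hence
    [m] can be read off level by level as a branch of a tree whose nodes are
    sets of primes, pruned by this congruence. The exponent [alpha] is not
    bounded beforehand, but whenever the product of a node is [1 + 2 ^ (k + 1)]
    modulo [2 ^ (k + 2)], the node survives only if an odd number of candidates
    of level [k + 1] is selected, and often no candidate is prime. For each of
    the finitely many pairs [(S, P)] the tree is in fact finite, of height less
    than [30], and the nodes satisfying all the conditions on [m] are the
    eleven listed numbers ([searches_succeed], [search_complete]).

    The search replaces primality of a candidate by the absence of small odd
    factors, which can only enlarge the tree. Conversely, the eleven numbers are
    Carmichael numbers by Korselt's criterion ([korselt]). *)

Set Implicit Arguments.
Unset Strict Implicit.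
Unset Printing Implicit Defensive.

Import GRing.Theory.

(** * Binary and unary natural numbers *)

Lemma nat_of_binE n : nat_of_bin n = N.to_nat n.
Proof.
case: n => //= p.
elim: p => [p /= -> | p /= -> |] //; rewrite NatTrec.doubleE -?mul2n; lia.
Qed.

Lemma nat_of_bin_inj : injective nat_of_bin.
Proof. exact: can_inj nat_of_binK. Qed.

Lemma nat_of_binD a b : nat_of_bin (a + b)%num = nat_of_bin a + nat_of_bin b.
Proof. rewrite !nat_of_binE; lia. Qed.

Lemma nat_of_binM a b : nat_of_bin (a * b)%num = nat_of_bin a * nat_of_bin b.
Proof. rewrite !nat_of_binE; lia. Qed.

Lemma nat_of_binX a k : nat_of_bin (a ^ N.of_nat k)%num = nat_of_bin a ^ k.
Proof.
elim: k => // k IHk.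
by rewrite Nnat.Nat2N.inj_succ N.pow_succ_r' nat_of_binM IHk expnS.
Qed.

Lemma nat_of_bin_pred a : nat_of_bin (N.pred a) = (nat_of_bin a).-1.
Proof. rewrite !nat_of_binE; lia. Qed.

Lemma ltb_bin a b : (a <? b)%num = (nat_of_bin a < nat_of_bin b).
Proof. rewrite !nat_of_binE; lia. Qed.

Lemma eq_bin0 a : (a == 0%num) = (nat_of_bin a == 0).
Proof. by rewrite -(inj_eq nat_of_bin_inj). Qed.

Lemma eq_bin1 a : (a == 1%num) = (nat_of_bin a == 1).
Proof. by rewrite -(inj_eq nat_of_bin_inj). Qed.

Lemma odd_bin n : N.odd n = odd (nat_of_bin n).
Proof.
by case: n => [|[p|p|]] //=; rewrite NatTrec.doubleE ?odd_double //= odd_double.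
Qed.

Lemma nat_of_bin_mod a b :
  nat_of_bin (a mod b)%num = nat_of_bin a %% nat_of_bin b.
Proof.
have [-> | b_neq0] := eqVneq b 0%num; first by rewrite modn0; case: a.
have := N.div_mod' a b; move/(congr1 nat_of_bin).
rewrite nat_of_binD nat_of_binM mulnC => ->.
rewrite modnMDl modn_small //.
have : (a mod b <? b)%num by apply/N.ltb_lt; apply: N.mod_lt; apply/eqP.
by rewrite ltb_bin.
Qed.

Lemma nat_of_bin_lcm a b :
  nat_of_bin (N.lcm a b) = lcmn (nat_of_bin a) (nat_of_bin b).
Proof.
have dvdNP x y : reflect (N.divide x y) (nat_of_bin x %| nat_of_bin y).
  apply: (iffP dvdnP) => [[z] | [z ->]].
    rewrite -(bin_of_natK z) -nat_of_binM => /nat_of_bin_inj ->.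
    by exists (bin_of_nat z).
  by exists z; rewrite nat_of_binM.
apply/eqP; rewrite eqn_dvd dvdn_lcm -(bin_of_natK (lcmn _ _)).
apply/and3P; split; apply/dvdNP.
- by apply: N.lcm_least; apply/dvdNP; rewrite bin_of_natK ?dvdn_lcml ?dvdn_lcmr.
- exact: N.divide_lcm_l.
exact: N.divide_lcm_r.
Qed.

Definition prod_bin (s : seq N) : N := foldr N.mul 1%num s.

Definition lcm_pred_bin (s : seq N) : N :=
  foldr (fun p => N.lcm (N.pred p)) 1%num s.

Definition pow2 k := iter k N.double 1%num.

Lemma prod_binE s : nat_of_bin (prod_bin s) = prodN s.
Proof.
rewrite /prodN; elim: s => [|p s IHs] /=; first by rewrite big_nil.
by rewrite big_cons nat_of_binM IHs.
Qed.

Lemma lcm_pred_binE s :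
  nat_of_bin (lcm_pred_bin s) = \big[lcmn/1]_(p <- map nat_of_bin s) p.-1.
Proof.
rewrite big_map; elim: s => [|p s IHs] /=; first by rewrite big_nil.
by rewrite big_cons nat_of_bin_lcm nat_of_bin_pred IHs.
Qed.

Lemma pow2E k : nat_of_bin (pow2 k) = 2 ^ k.
Proof.
elim: k => //= k IHk.
have -> : N.double (pow2 k) = (2 * pow2 k)%num by [].
by rewrite nat_of_binM IHk expnS.
Qed.

(** * Korselt's criterion *)

Lemma generator_Fp p : prime p -> exists u : {unit 'F_p}, #[u]%g = p.-1.
Proof.
move=> p_prime.
have /cyclicP[u def_u] := field_unit_group_cyclic [set: {unit 'F_p}]%G.
by exists u; rewrite orderE -def_u card_finField_unit card_Fp.
Qed.

Lemma carmichael_gt1 m : carmichael m -> 1 < m.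
Proof. by case=> /andP[]. Qed.

Lemma carmichael_Fp m p (x : 'F_p) :
  carmichael m -> prime p -> p %| m -> (x ^+ m = x)%R.
Proof.
move=> [_ cm] p_prime p_m; apply/eqP; rewrite -subr_eq0 -(natr_Zp x).
have /eqP := cm (nat_of_ord x)%:Z%R; rewrite eqz_mod_dvd => m_dvd.
have: (p%:Z %| ((nat_of_ord x)%:Z ^+ m - (nat_of_ord x)%:Z)%R)%Z.
  by apply: dvdz_trans m_dvd; rewrite dvdzE.
by rewrite (dvdz_pcharf (pchar_Fp p_prime)) rmorphB rmorphXn.
Qed.

(** A generator of the cyclic group of units of ['F_p] has order [p.-1], and
    its power [m.-1] is [1]. *)
Lemma carmichael_pred_dvd m p :
  carmichael m -> prime p -> p %| m -> p.-1 %| m.-1.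
Proof.
move=> cm p_prime p_m; have [u ord_u] := generator_Fp p_prime.
have := carmichael_Fp (FinRing.uval u) cm p_prime p_m.
rewrite -FinRing.val_unitX => /val_inj.
rewrite -{1}(ltn_predK (carmichael_gt1 cm)) expgS -[RHS]mulg1 => /mulgI /eqP.
by rewrite -order_dvdn ord_u.
Qed.

(** If [p ^ 2] divided [m] then, as it divides [p ^ m], the congruence
    [p ^ m = p] modulo [m] would make it divide [p]. *)
Lemma carmichael_squarefree m p :
  carmichael m -> prime p -> ~~ (p ^ 2 %| m).
Proof.
move=> cm p_prime; apply/negP => p2_m; have [_ /(_ p%:Z%R) /eqP] := cm.
rewrite eqz_mod_dvd => m_dvd.
have : ((p ^ 2)%:Z%R %| (p%:Z ^+ m - p%:Z)%R)%Z.
  by apply: dvdz_trans m_dvd; rewrite dvdzE.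
rewrite rpredBl; last by rewrite dvdzE abszX dvdn_exp2l // carmichael_gt1.
rewrite dvdzE => /(dvdn_leq (prime_gt0 p_prime)).
by rewrite leqNgt -{1}(expn1 p) ltn_exp2l // prime_gt1.
Qed.

Lemma carmichael_mod_L m : carmichael m -> m = 1 %[mod carmichael_L m].
Proof.
move=> cm; have m_gt0 : 0 < m := ltnW (carmichael_gt1 cm).
apply/eqP; rewrite eqn_mod_dvd // subn1 /carmichael_L big_seq.
elim/big_ind: _ => [|x y x_m y_m|p].
- exact: dvd1n.
- by rewrite dvdn_lcm x_m.
by rewrite mem_primes => /and3P[p_prime _ p_m]; apply: carmichael_pred_dvd.
Qed.

Lemma prod_primes m :
  0 < m -> (forall p, prime p -> ~~ (p ^ 2 %| m)) ->
  \prod_(p <- primes m) p = m.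
Proof.
move=> m_gt0 sqf; rewrite [RHS]prod_prime_decomp // prime_decompE big_map /=.
rewrite big_seq [RHS]big_seq; apply: eq_bigr => p; rewrite -logn_gt0 => l_gt0.
have p_prime : prime p by move: l_gt0; rewrite logn_gt0 mem_primes; case/andP.
have := sqf p p_prime; rewrite pfactor_dvdn // => {}sqf.
by have -> : logn p m = 1 by lia.
Qed.

Lemma primes_prod s :
  uniq s -> all prime s -> perm_eq (primes (\prod_(p <- s) p)) s.
Proof.
move=> us /allP s_prime; apply: uniq_perm => // [|q]; first exact: primes_uniq.
have s_gt0 : 0 < \prod_(p <- s) p.
  by rewrite big_seq; apply: prodn_cond_gt0 => p /s_prime/prime_gt0.
rewrite mem_primes s_gt0 /=; apply/andP/idP => [[q_prime]|q_s].
  rewrite big_seq; elim/big_ind: _ => [|x y IHx IHy|p p_s].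
  - by rewrite dvdn1 => /eqP q1; rewrite q1 in q_prime.
  - by rewrite Euclid_dvdM // => /orP[/IHx|/IHy].
  by rewrite dvdn_prime2 ?(s_prime p p_s) // => /eqP ->.
by split; rewrite ?s_prime // (perm_big _ (perm_to_rem q_s)) big_cons dvdn_mulr.
Qed.

Lemma carmichael_L_prod s :
  uniq s -> all prime s ->
  carmichael_L (\prod_(p <- s) p) = \big[lcmn/1]_(p <- s) p.-1.
Proof. by move=> us s_prime; apply: perm_big; apply: primes_prod. Qed.

(** By Fermat's little theorem [a ^ m = a] modulo each prime of [s], and these
    primes are pairwise coprime. *)
Lemma korselt s m :
  uniq s -> all prime s -> 1 < size s -> \prod_(p <- s) p = m ->
  all (fun p => p.-1 %| m.-1) s -> carmichael m.
Proof.
move=> us s_prime s_gt1 def_m /allP s_dvd.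
have m_gt0 : 0 < m.
  rewrite -def_m big_seq.
  by apply: prodn_cond_gt0 => p /(allP s_prime)/prime_gt0.
have Pm := primes_prod us s_prime; rewrite def_m in Pm.
split.
  rewrite /composite; apply/andP; split.
    case: m m_gt0 Pm {def_m s_dvd} => [|[|]] // _; rewrite /= perm_sym.
    by move/perm_nilP => s0; rewrite s0 in s_gt1.
  apply/negP => m_prime; move/perm_size: Pm; rewrite primes_prime //= => sz.
  by rewrite -sz in s_gt1.
move=> a; apply/eqP; rewrite eqz_mod_dvd dvdzE /= -[X in X %| _]def_m.
have: all prime s /\ {in s, forall p, p %| `|(a ^+ m - a)%R|}.
  split=> // p p_s; have p_prime := allP s_prime p p_s.
  have -> : p %| `|(a ^+ m - a)%R| = (p%:Z %| (a ^+ m - a)%R)%Z.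
    by rewrite dvdzE.
  rewrite (dvdz_pcharf (pchar_Fp p_prime)) rmorphB rmorphXn /= subr_eq0.
  set x := (_%:~R)%R; have [-> | x_neq0] := eqVneq x 0%R.
    by rewrite expr0n gtn_eqF.
  have /dvdnP[k def_k] := s_dvd p p_s.
  rewrite -(prednK m_gt0) def_k exprS mulnC exprM.
  have -> : (x ^+ p.-1 = 1)%R.
    apply: (mulfI x_neq0); rewrite -exprS prednK ?prime_gt0 //.
    by have := expf_card x; rewrite card_Fp // mulr1.
  by rewrite expr1n mulr1.
move: (`|_|) => n [{}s_prime s_n].
elim: s us s_prime s_n {s_gt1 def_m s_dvd Pm} => [|p s IHs] /=.
  by rewrite big_nil dvd1n.
move=> /andP[p_s us] /andP[p_prime s_prime] s_n; rewrite big_cons Gauss_dvd.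
  rewrite s_n ?mem_head // IHs // => q q_s.
  by rewrite s_n // in_cons q_s orbT.
rewrite prime_coprime //; apply: contra p_s => p_dvd.
rewrite -(perm_mem (primes_prod us s_prime)) mem_primes p_prime p_dvd andbT.
by rewrite big_seq; apply: prodn_cond_gt0 => q /(allP s_prime)/prime_gt0.
Qed.

(** * Trial division *)

(** Trial division by [d], [d + 2], [d + 4] and so on, at most [fuel] times.
    When the fuel runs out the answer is [true], so that [false] always means
    composite, while [true] means prime only for [n] below the square of the
    first divisor left untried. *)
Fixpoint no_odd_factor (fuel : nat) (d n : N) : bool :=
  if fuel is f.+1 then
    if (n <? d * d)%num then true
    else if (n mod d)%num == 0%num then false
    else no_odd_factor f (d + 2)%num n
  else true.

Lemma prime_no_odd_factor f d n :
  1 < nat_of_bin d -> prime (nat_of_bin n) -> no_odd_factor f d n.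
Proof.
elim: f d => //= f IHf d d_gt1 n_prime; case: ifPn => //.
rewrite ltb_bin nat_of_binM -leqNgt => d2_n; case: ifPn => [|_].
  rewrite eq_bin0 nat_of_bin_mod => d_n; have [_ n_div] := primeP n_prime.
  have /orP[] := n_div _ d_n => /eqP dE; first by rewrite dE in d_gt1.
  by move: d2_n; rewrite dE leqNgt ltn_Pmull ?prime_gt1 ?prime_gt0.
by apply: IHf => //; rewrite nat_of_binD; lia.
Qed.

Lemma no_odd_factor_prime f d n :
  odd (nat_of_bin n) -> 1 < nat_of_bin n -> odd (nat_of_bin d) ->
  (forall q, prime q -> q %| nat_of_bin n -> nat_of_bin d <= q) ->
  nat_of_bin n < (nat_of_bin d + 2 * f) ^ 2 ->
  no_odd_factor f d n -> prime (nat_of_bin n).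
Proof.
move=> n_odd n_gt1; have n_gt0 := ltnW n_gt1.
have done_at e : (forall q, prime q -> q %| nat_of_bin n -> e <= q) ->
    nat_of_bin n < e ^ 2 -> prime (nat_of_bin n).
  move=> e_le n_lt; apply: ltn_pdiv2_prime => //; apply: leq_trans n_lt _.
  by rewrite leq_exp2r // e_le ?pdiv_prime ?pdiv_dvd.
elim: f d => [|f IHf] d d_odd d_le /=.
  by rewrite muln0 addn0 => /(done_at _ d_le).
case: ifPn => [|_ n_lt].
  by rewrite ltb_bin nat_of_binM => /(done_at _ d_le).
case: ifPn => //; rewrite eq_bin0 nat_of_bin_mod => d_ndvd.
have d2 : nat_of_bin (d + 2)%num = (nat_of_bin d).+2.
  by rewrite nat_of_binD addn2.
apply: IHf; rewrite d2 /= ?negbK //; last by move: n_lt; congr (_ < _ ^ _); lia.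
(* A prime factor of [n] differs from [d], which does not divide [n], and from
   [d + 1], which is even. *)
move=> q q_prime q_n; have := d_le q q_prime q_n.
rewrite leq_eqVlt => /predU1P[dq|].
  by move: d_ndvd; rewrite dq -/(dvdn q _) q_n.
rewrite leq_eqVlt => /predU1P[dq|//]; have : odd q := dvdn_odd q_n n_odd.
by rewrite -dq /= d_odd.
Qed.

(** The fuel [25000] lets the trial divisors pass [46340], the integer part of
    the square root of [2 ^ 31 - 1], the largest number to be tested. *)
Definition trial_prime (n : N) : bool :=
  [&& N.odd n, (1 <? n)%num, (n <? (3 + 2 * 25000) ^ 2)%num
    & no_odd_factor (N.to_nat 25000) 3%num n].

Lemma trial_primeP n : trial_prime n -> prime (nat_of_bin n).
Proof.
case/and4P; rewrite odd_bin => n_odd n_gt1 n_lt.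
rewrite ltb_bin in n_gt1; apply: no_odd_factor_prime.
- exact: n_odd.
- exact: n_gt1.
- by [].
- by move=> q q_prime q_n; rewrite odd_prime_gt2 // (dvdn_odd q_n).
have -> : (nat_of_bin 3 + 2 * N.to_nat 25000) ^ 2 =
          nat_of_bin ((3 + 2 * 25000) ^ 2)%num.
  rewrite N.pow_2_r nat_of_binM !nat_of_binD !nat_of_binM.
  by rewrite -nat_of_binE -mulnn.
by rewrite -ltb_bin.
Qed.

(** * The eleven Carmichael numbers *)

(** A triple [(s, a, P)] stands for the number [m], the product of [s], with
    [L = 2 ^ a * P ^ 2]. *)
Definition entries : seq (seq N * nat * N) :=
  [:: ([:: 3; 11; 17; 401; 641; 1601]%num, 7, 5%num);
      ([:: 5; 7; 17; 19; 73]%num, 4, 3%num);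
      ([:: 5; 7; 19; 73; 97; 257]%num, 8, 3%num);
      ([:: 5; 13; 257; 577; 1153]%num, 8, 3%num);
      ([:: 5; 37; 73; 257; 577; 769]%num, 8, 3%num);
      ([:: 5; 37; 73; 193; 257; 1153]%num, 8, 3%num);
      ([:: 5; 13; 257; 577; 1153; 18433]%num, 11, 3%num);
      ([:: 5; 257; 37; 73; 577; 12289; 18433]%num, 12, 3%num);
      ([:: 5; 7; 13; 19; 37; 73; 193; 257; 577; 1153]%num, 8, 3%num);
      ([:: 5; 7; 13; 19; 37; 73; 257; 769; 1153]%num, 8, 3%num);
      ([:: 5; 7; 19; 73; 97; 193; 577; 769; 12289; 147457; 65537;
           1179649; 786433]%num, 18, 3%num)].

Lemma carmichael_list_entries :
  carmichael_list =
  [seq (prodN e.1.1, 2 ^ e.1.2 * nat_of_bin e.2 ^ 2) | e <- entries].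
Proof. reflexivity. Qed.

Definition verified (e : seq N * nat * N) :=
  let: (s, a, P) := e in
  let l := (pow2 a * (P * P))%num in
  [&& all trial_prime s, uniq s, 1 < size s, lcm_pred_bin s == l
    & (prod_bin s mod l == 1)%num].

Lemma entries_verified : all verified entries.
Proof. by vm_compute. Qed.

Lemma entries_carmichael e : e \in entries ->
  carmichael (prodN e.1.1) /\
  carmichael_L (prodN e.1.1) = 2 ^ e.1.2 * nat_of_bin e.2 ^ 2.
Proof.
move/(allP entries_verified).
case: e => [[s a] P] /= /and5P[s_prime us s_gt1 /eqP lE].
have uns : uniq (map nat_of_bin s).
  by rewrite map_inj_uniq //; apply: nat_of_bin_inj.
have ns_prime : all prime (map nat_of_bin s).
  by rewrite all_map; apply: sub_all s_prime => p; apply: trial_primeP.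
have prodE : \prod_(p <- map nat_of_bin s) p = prodN s by rewrite big_map.
rewrite eq_bin1 nat_of_bin_mod prod_binE -lE lcm_pred_binE.
set L := \big[lcmn/1]_(p <- _) _ => /eqP prod1.
split; last first.
  by rewrite -prodE carmichael_L_prod // -lcm_pred_binE lE !nat_of_binM pow2E
             mulnn.
apply: korselt prodE _ => //; first by rewrite size_map.
apply/allP => p p_s; apply: (@dvdn_trans L).
  by rewrite /L (perm_big _ (perm_to_rem p_s)) big_cons dvdn_lcml.
by rewrite [X in X.-1](divn_eq _ L) prod1 addn1 dvdn_mull.
Qed.

(** * The search *)

Fixpoint subseqs (T : Type) (s : seq T) : seq (seq T) :=
  if s is x :: s' then
    let r := subseqs s' in [seq x :: c | c <- r] ++ r
  else [:: [::]].

Lemma mem_subseqs (T : eqType) (a : pred T) (s : seq T) :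
  filter a s \in subseqs s.
Proof.
elim: s => //= x s IHs; rewrite mem_cat.
by case: ifP => _; [rewrite map_f | rewrite IHs orbT].
Qed.

(** Throughout the search [t] is the power [2 ^ k] for the current level [k],
    and [S] is the set of all Fermat primes of the number sought. Those of level
    [k] are therefore forced, while any subset of the other candidates of
    level [k] may be selected. *)
Definition fermat_level (S : seq N) (t : N) :=
  [seq q <- [:: t + 1]%num | q \in S].

(** The bound [500] on the number of trial divisions is a compromise: it is
    large enough for the trees to be finite, and for their solutions to be
    exactly the eleven numbers. *)
Definition multiple_level (P t : N) :=
  [seq q <- [:: t * P + 1; t * (P * P) + 1]%num | no_odd_factor 500 3%num q].

Definition extensions S P t (nodes : seq (seq N)) :=
  [seq fermat_level S t ++ c ++ s
     | s <- nodes, c <- subseqs (multiple_level P t)].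

(** What is tested of a node at the level [alpha] of the number sought. The test
    that the node contains [S] matters at levels below those of the largest
    elements of [S], where it discards Carmichael numbers with fewer Fermat
    primes, such as [7 * 13 * 19]. *)
Definition solution (S : seq N) (P t : N) (s : seq N) : bool :=
  let l := (t * (P * P))%num in
  [&& all (mem s) S, lcm_pred_bin s == l & (prod_bin s mod l == 1)%num].

Definition tabulated (P t : N) (s : seq N) : bool :=
  has (fun e : seq N * nat * N =>
         [&& prod_bin e.1.1 == prod_bin s, pow2 e.1.2 == t & e.2 == P]) entries.

(** The search succeeds when the tree below [nodes] dies out within [fuel]
    levels and all its solutions are tabulated. *)
Fixpoint search (fuel : nat) S P t nodes : bool :=
  if nodes is [::] then true else
  if fuel is f.+1 then
    let ext := extensions S P t nodes in
    if all (tabulated P t) [seq s <- ext | solution S P t s] then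
      search f S P (N.double t)
        [seq s <- ext | (prod_bin s mod N.double t == 1)%num]
    else false
  else false.

Definition fermat_bins : seq N := [:: 3; 5; 17; 257; 65537]%num.

Definition fermat_sets := [seq S <- subseqs fermat_bins | S != [::]].

(** The odd primes dividing [\prod S - 1] for some [S] in [fermat_sets]. *)
Definition candidate_primes : seq N :=
  [:: 3; 5; 7; 11; 13; 19; 29; 31; 41; 43; 47; 83; 107; 113; 127; 131; 151; 241;
      331; 467; 2579; 6553; 10631; 13159; 19661; 45083; 491527; 8355967;
      18046081; 22605091; 25264513; 2147483647]%num.

Lemma fermat_bins_trial_prime : all trial_prime fermat_bins.
Proof. by vm_compute. Qed.

Lemma candidate_primes_trial_prime : all trial_prime candidate_primes.
Proof. by vm_compute. Qed.

(** The exponent [16] is the one of [2] in [65537 - 1], the largest exponent in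
    the factorizations of the numbers [\prod S - 1]. *)
Lemma candidate_primes_complete :
  let X := ((2 * prod_bin candidate_primes) ^ N.of_nat 16)%num in
  all (fun S => (X mod N.pred (prod_bin S) == 0)%num) fermat_sets.
Proof. by vm_compute. Qed.

Lemma searches_succeed :
  all (fun S => all (fun P =>
         if (prod_bin S mod P == 1)%num then search 30 S P 2%num [:: [::]]
         else true) candidate_primes) fermat_sets.
Proof. by vm_compute. Qed.

Lemma mem_candidate_primes (S : seq N) P :
  S \in fermat_sets -> prime P -> odd P -> prodN S = 1 %[mod P] ->
  exists2 p, p \in candidate_primes & P = nat_of_bin p.
Proof.
move=> S_sets P_prime P_odd S1.
have S_gt0 : 0 < prodN S.
  by case: (prodN S) S1 => //; rewrite mod0n modn_small ?prime_gt1.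
have P_dvd : P %| (2 * prodN candidate_primes) ^ 16.
  apply: (@dvdn_trans (prodN S).-1).
    by rewrite -subn1 -eqn_mod_dvd ?S1.
  have := allP candidate_primes_complete _ S_sets.
  rewrite eq_bin0 nat_of_bin_mod nat_of_bin_pred prod_binE.
  by rewrite nat_of_binX nat_of_binM prod_binE; apply.
move: P_dvd; rewrite Euclid_dvdX // Euclid_dvdM // dvdn_prime2 // andbT.
case/orP=> [/eqP PE|]; first by rewrite PE in P_odd.
have := candidate_primes_trial_prime; rewrite /prodN.
elim: candidate_primes => [|p ps IHs].
  by rewrite big_nil dvdn1 => _ /eqP PE; rewrite PE in P_prime.
rewrite big_cons /= => /andP[/trial_primeP p_prime /IHs{}IHs].
rewrite Euclid_dvdM // dvdn_prime2 // => /orP[/eqP PE|/IHs[q q_ps PE]].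
  by exists p; rewrite ?mem_head.
by exists q; rewrite // in_cons q_ps orbT.
Qed.

(** * Levels of the prime factors *)

Definition prime_shape (m alpha P : nat) : Prop :=
  forall p, p \in primes m ->
  exists k j, [/\ 0 < k <= alpha, j <= 2 & p = 2 ^ k * P ^ j + 1].

(** Since [p.-1] divides [2 ^ alpha * P ^ 2], its parts at [2] and prime to [2]
    are powers of [2] and [P]. The exponent of [2] is positive because [m] is
    odd, being [1] modulo the even number [L]. *)
Lemma carmichael_shape m alpha P :
  carmichael m -> 0 < alpha -> prime P -> odd P ->
  carmichael_L m = 2 ^ alpha * P ^ 2 -> prime_shape m alpha P.
Proof.
move=> cm a_gt0 P_prime P_odd LE p p_m.
have cop k : coprime (2 ^ k) (P ^ 2).
  by rewrite coprimeXl // coprimeXr // coprime2n.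
have p_L : p.-1 %| 2 ^ alpha * P ^ 2.
  rewrite -LE /carmichael_L (perm_big _ (perm_to_rem p_m)) big_cons.
  exact: dvdn_lcml.
have [p_prime p_dvd] : prime p /\ p %| m.
  by move: p_m; rewrite mem_primes => /and3P[].
have d_gt0 : 0 < p.-1 by case: p p_prime {p_m p_L p_dvd} => [|[]].
have m_odd : odd m.
  have L_even : 2 %| carmichael_L m by rewrite LE dvdn_mulr // dvdn_exp.
  have : m = 1 %[mod 2].
    by rewrite -(modn_dvdm m L_even) carmichael_mod_L // modn_dvdm.
  by rewrite !modn2 => /(congr1 (fun n => n == 1)); case: (odd m).
have p_odd := dvdn_odd p_dvd m_odd.
have d_even : 2 %| p.-1 by rewrite dvdn2 -subn1 oddB ?prime_gt0 // p_odd.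
pose k := logn 2 p.-1; pose o := (p.-1)`_2^'.
have dE : p.-1 = 2 ^ k * o by rewrite -p_part partnC.
have k_dvd : 2 ^ k %| 2 ^ alpha.
  rewrite -(Gauss_dvdl _ (cop k)).
  by apply: dvdn_trans p_L; rewrite dE dvdn_mulr.
have o_dvd : o %| P ^ 2.
  rewrite -(@Gauss_dvdr _ (2 ^ alpha)).
    by apply: dvdn_trans p_L; rewrite dE dvdn_mull.
  by rewrite coprimeXr // coprime_sym coprime2n odd_2'nat part_pnat.
have /dvdn_pfactor-/(_ P_prime)[j j_le oE] := o_dvd.
exists k, j; split => //; last by rewrite -oE -dE addn1 prednK // prime_gt0.
by rewrite logn_gt0 mem_primes d_gt0 d_even -(@dvdn_Pexp2l 2).
Qed.

Lemma logn2_shape P k j : odd P -> logn 2 (2 ^ k * P ^ j + 1).-1 = k.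
Proof.
move=> P_odd; have P_gt0 : 0 < P by case: P P_odd.
rewrite addn1 lognM ?expn_gt0 ?P_gt0 // pfactorK // lognX lognE /=.
by rewrite dvdn2 P_odd andbF muln0 addn0.
Qed.

(** The selection made at level [k] by the branch of the tree leading to [m]. *)
Definition level (S : seq N) (P : N) (m k : nat) : seq N :=
  fermat_level S (pow2 k) ++
  [seq q <- multiple_level P (pow2 k) | nat_of_bin q \in primes m].

Fixpoint branch (S : seq N) (P : N) (m k : nat) : seq N :=
  if k is k'.+1 then level S P m k ++ branch S P m k' else [::].

Lemma mem_level (S : seq N) (P : N) m alpha k x :
  odd (nat_of_bin P) -> prime_shape m alpha (nat_of_bin P) ->
  {in S, forall q, nat_of_bin q \in primes m} ->
  (forall q k, nat_of_bin q \in primes m -> 0 < k ->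
     nat_of_bin q = 2 ^ k + 1 -> q \in S) ->
  (x \in map nat_of_bin (level S P m k)) =
  (x \in primes m) && (logn 2 x.-1 == k).
Proof.
move=> P_odd m_shape S_sub S_all.
rewrite -(bin_of_natK x); move: (bin_of_nat x) => {}x.
rewrite mem_map; last exact: nat_of_bin_inj.
rewrite mem_cat !mem_filter !inE.
have eqE j : (x == (pow2 k * P ^ N.of_nat j + 1)%num) =
             (nat_of_bin x == 2 ^ k * nat_of_bin P ^ j + 1).
  by rewrite -(inj_eq nat_of_bin_inj) nat_of_binD nat_of_binM nat_of_binX pow2E.
have := eqE 0; have := eqE 1; have := eqE 2.
rewrite N.pow_2_r N.pow_1_r N.pow_0_r N.mul_1_r.
rewrite !expn0 !expn1 !muln1 => -> -> ->.
apply/idP/andP => [/orP[/andP[x_S /eqP xE]|]|[x_m /eqP lE]].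
- by rewrite S_sub // xE -[2 ^ k]muln1 -(expn0 (nat_of_bin P)) logn2_shape.
- case/and3P=> x_m _ /orP[] /eqP xE; rewrite x_m xE ?logn2_shape //.
  by rewrite -{1}(expn1 (nat_of_bin P)) logn2_shape.
have x_prime : prime (nat_of_bin x).
  by move: x_m; rewrite mem_primes => /andP[].
have [k' [j [/andP[k_gt0 _] j_le xE]]] := m_shape _ x_m.
have {}lE : k' = k by rewrite -lE xE logn2_shape.
rewrite {k'}lE in k_gt0 xE.
rewrite x_m prime_no_odd_factor //= xE.
case: j j_le xE => [|[|[|//]]] _ xE.
- by rewrite muln1 eqxx (S_all x k) // xE muln1.
- by rewrite expn1 eqxx orbT.
by rewrite eqxx !orbT.
Qed.

Lemma uniq_level (S : seq N) (P : N) m k :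
  odd (nat_of_bin P) -> 1 < nat_of_bin P -> uniq (level S P m k).
Proof.
rewrite /level => P_odd P_gt1; set t := pow2 k.
apply: (@subseq_uniq _ _ ([:: t + 1] ++ [:: t * P + 1; t * (P * P) + 1])%num).
  apply: cat_subseq; first exact: filter_subseq.
  exact: subseq_trans (filter_subseq _ _) (filter_subseq _ _).
have t_gt0 : 0 < nat_of_bin t by rewrite pow2E expn_gt0.
rewrite -(map_inj_uniq nat_of_bin_inj) /= !nat_of_binD !nat_of_binM.
rewrite !inE !eqn_add2r -{1 3}[nat_of_bin t]muln1 !eqn_pmul2l //.
have := ltn_Pmull P_gt1 (ltnW P_gt1).
move: (nat_of_bin P) P_gt1 => n n_gt1; move: (n * n) => n2 n_lt; lia.
Qed.

Lemma perm_branch (S : seq N) (P : N) m alpha k :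
  odd (nat_of_bin P) -> 1 < nat_of_bin P ->
  prime_shape m alpha (nat_of_bin P) ->
  {in S, forall q, nat_of_bin q \in primes m} ->
  (forall q k, nat_of_bin q \in primes m -> 0 < k ->
     nat_of_bin q = 2 ^ k + 1 -> q \in S) ->
  perm_eq (map nat_of_bin (branch S P m k))
          [seq p <- primes m | logn 2 p.-1 <= k].
Proof.
move=> P_odd P_gt1 m_shape S_sub S_all; elim: k => [|k IHk].
  have -> : [seq p <- primes m | logn 2 p.-1 <= 0] = [::] => //.
  apply/eqP; rewrite -[_ == _]negbK -has_filter; apply/hasPn => p p_m.
  have [k [j [/andP[k_gt0 _] _ ->]]] := m_shape _ p_m.
  by rewrite logn2_shape // -ltnNge.
rewrite [branch _ _ _ _]/= map_cat.
apply: perm_trans (permEl (perm_filterC (fun p => logn 2 p.-1 == k.+1) _)).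
rewrite -!filter_predI; apply: perm_cat.
  apply: uniq_perm; first by rewrite (map_inj_uniq nat_of_bin_inj) uniq_level.
    exact/filter_uniq/primes_uniq.
  move=> x; rewrite (mem_level _ _ P_odd m_shape S_sub S_all).
  by rewrite mem_filter /= andbC; case: eqP => //= ->; rewrite leqnn.
have /eq_filter-> // : [predI [pred p | logn 2 p.-1 != k.+1]
                            & [pred p | logn 2 p.-1 <= k.+1]]
                       =1 [pred p | logn 2 p.-1 <= k].
by move=> p /=; rewrite -ltn_neqAle ltnS.
Qed.

Lemma prod_mod1 (s : seq nat) (a : pred nat) d :
  {in s, forall p, a p -> p = 1 %[mod d]} ->
  \prod_(p <- s | a p) p = 1 %[mod d].
Proof.
move=> s1; rewrite big_seq_cond.
elim/big_rec: _ => // p n /andP[p_s ap] n1.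
by rewrite -modnMm (s1 p) // n1 modnMm muln1.
Qed.

Lemma prod_mod_drop (s : seq nat) (a : pred nat) d :
  {in s, forall p, ~~ a p -> p = 1 %[mod d]} ->
  \prod_(p <- s | a p) p = \prod_(p <- s) p %[mod d].
Proof.
move=> s1; rewrite [X in _ = X %[mod d]](bigID a) /=.
by rewrite -[RHS]modnMmr (prod_mod1 s1) modnMmr muln1.
Qed.

(** As long as its congruences hold, the branch of [m] stays in the tree. A
    successful search cannot exhaust the tree before level [alpha], and so it
    has met the branch at that level. *)
Lemma search_complete fuel (S : seq N) (P : N) m alpha k nodes :
  (forall j, j < alpha ->
     nat_of_bin (prod_bin (branch S P m j)) = 1 %[mod 2 ^ j.+1]) ->
  search fuel S P (pow2 k.+1) nodes -> branch S P m k \in nodes -> k < alpha ->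
  solution S P (pow2 alpha) (branch S P m alpha) ->
  tabulated P (pow2 alpha) (branch S P m alpha).
Proof.
move=> cong1; elim: fuel k nodes => [|f IHf] k [|s0 nodes] // srch Bk k_lt sol.
move: srch; rewrite [search _ _ _ _ _]/=; set nds := s0 :: nodes in Bk *.
set ext := extensions _ _ _ _; case: ifP => // /allP ext_ok srch.
have B_ext : branch S P m k.+1 \in ext.
  apply/allpairsPdep; exists (branch S P m k).
  exists [seq q <- multiple_level P (pow2 k.+1) | nat_of_bin q \in primes m].
  by rewrite /= -catA Bk mem_subseqs.
move: k_lt; rewrite leq_eqVlt => /predU1P[kE|k_lt].
  by rewrite -kE in sol *; apply: ext_ok; rewrite mem_filter sol.
apply: (IHf k.+1 _ srch) => //; rewrite mem_filter B_ext andbT.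
have -> : N.double (pow2 k.+1) = pow2 k.+2 by [].
rewrite eq_bin1 nat_of_bin_mod pow2E cong1 // modn_small //.
by rewrite (@ltn_exp2l 2 0).
Qed.

(** * The classification *)

Theorem theorem1p1 :
  (forall m alpha P : nat,
     carmichael m ->
     0 < alpha -> prime P -> odd P ->
     carmichael_L m = 2 ^ alpha * P ^ 2 ->
     (exists2 q, q \in known_fermat_primes & q %| m) ->
     (forall p k : nat, prime p -> p %| m -> 0 < k -> p = 2 ^ k + 1 ->
        p \in known_fermat_primes) ->
     (m, carmichael_L m) \in carmichael_list /\ (P = 5 \/ P = 3))
  /\ (forall n l : nat, (n, l) \in carmichael_list ->
        carmichael n /\ carmichael_L n = l).
Proof.
split; last first.
  move=> n l; rewrite carmichael_list_entries => /mapP[e e_in [-> ->]].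
  exact: entries_carmichael.
(* Generalizing the list of Fermat primes keeps unification from unfolding it
   into unary numbers. *)
have knownE : known_fermat_primes = map nat_of_bin fermat_bins := erefl.
move: known_fermat_primes knownE => known_primes knownE.
move=> m alpha P cm a_gt0 P_prime P_odd LE [x x_known x_m] known.
have m_gt0 : 0 < m := ltnW (carmichael_gt1 cm).
have m_shape := carmichael_shape cm a_gt0 P_prime P_odd LE.
have prod_m : \prod_(p <- primes m) p = m.
  by apply: prod_primes => // p; apply: carmichael_squarefree.
have m1 d : d %| 2 ^ alpha * P ^ 2 -> m = 1 %[mod d].
  rewrite -LE => d_L.
  by rewrite -(modn_dvdm m d_L) carmichael_mod_L // modn_dvdm.
pose S := [seq q <- fermat_bins | nat_of_bin q \in primes m].
have S_sub : {in S, forall q, nat_of_bin q \in primes m}.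
  by move=> q; rewrite mem_filter => /andP[].
have S_all q k :
    nat_of_bin q \in primes m -> 0 < k -> nat_of_bin q = 2 ^ k + 1 -> q \in S.
  move=> q_m k_gt0 qE; rewrite mem_filter q_m -(mem_map nat_of_bin_inj) -knownE.
  by move: q_m; rewrite mem_primes => /and3P[q_prime _ q_m]; apply: known qE.
have S_set : S \in fermat_sets.
  rewrite mem_filter mem_subseqs andbT.
  move: x_known; rewrite knownE => /mapP[q q_F xE].
  suff q_S : q \in S by apply/eqP => S0; rewrite S0 in q_S.
  rewrite mem_filter q_F mem_primes m_gt0 -xE x_m andbT xE /= andbT.
  exact/trial_primeP/(allP fermat_bins_trial_prime).
have other1 :
    {in primes m, forall p, p \notin known_primes -> p = 1 %[mod P]}.
  move=> p p_m p_unknown; have [k [j [/andP[k_gt0 _] _ pE]]] := m_shape _ p_m.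
  case: j pE => [pE|j ->]; last by rewrite expnS mulnCA -modnDml modnMr.
  move: p_m; rewrite mem_primes => /and3P[p_prime _ p_m].
  rewrite expn0 muln1 in pE.
  by case/negP: p_unknown; apply: (known p k p_prime p_m k_gt0 pE).
have S1 : prodN S = 1 %[mod P].
  have -> : prodN S = \prod_(p <- primes m | p \in known_primes) p.
    rewrite -[RHS]big_filter /prodN -(big_map nat_of_bin xpredT id).
    apply: perm_big; apply: uniq_perm.
    - by rewrite (map_inj_uniq nat_of_bin_inj) filter_uniq.
    - exact/filter_uniq/primes_uniq.
    move=> p; rewrite -(bin_of_natK p) (mem_map nat_of_bin_inj) !mem_filter.
    by rewrite knownE (mem_map nat_of_bin_inj) andbC.
  rewrite (prod_mod_drop other1) prod_m; apply: m1.
  by rewrite dvdn_mull // dvdn_exp.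
have [Pb Pb_in PE] := mem_candidate_primes S_set P_prime P_odd S1.
rewrite PE in P_prime P_odd LE m_shape m1 S1.
pose B k := branch S Pb m k.
have B_perm k := perm_branch k P_odd (prime_gt1 P_prime) m_shape S_sub S_all.
have B_all : perm_eq (map nat_of_bin (B alpha)) (primes m).
  have /all_filterP <- // : all (fun p => logn 2 p.-1 <= alpha) (primes m).
  apply/allP => p /m_shape[k [j [/andP[_ k_le] _ ->]]].
  by rewrite logn2_shape.
have B_prod : nat_of_bin (prod_bin (B alpha)) = m.
  by rewrite prod_binE -[RHS]prod_m -(perm_big _ B_all) /= big_map.
have tE : nat_of_bin (pow2 alpha * (Pb * Pb))%num = carmichael_L m.
  by rewrite LE !nat_of_binM pow2E mulnn.
have cong1 j : j < alpha -> nat_of_bin (prod_bin (B j)) = 1 %[mod 2 ^ j.+1].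
  move=> j_lt; rewrite prod_binE /prodN -(big_map nat_of_bin xpredT id).
  rewrite (perm_big _ (B_perm j)) /= big_filter prod_mod_drop ?prod_m.
    by rewrite m1 // dvdn_mulr // dvdn_exp2l.
  move=> p /m_shape[k [i [_ _ ->]]]; rewrite logn2_shape // -ltnNge => k_gt.
  by rewrite -modnDml -(subnKC k_gt) expnD -mulnA modnMr.
have sol : solution S Pb (pow2 alpha) (B alpha).
  rewrite /solution; apply/and3P; split.
  - apply/allP => q q_S; have := S_sub q q_S.
    by rewrite -(perm_mem B_all) (mem_map nat_of_bin_inj).
  - rewrite -(inj_eq nat_of_bin_inj) tE lcm_pred_binE.
    by apply/eqP; apply: perm_big.
  rewrite eq_bin1 nat_of_bin_mod tE B_prod carmichael_mod_L //.
  rewrite modn_small // LE (@leq_trans (2 ^ alpha)) ?(@ltn_exp2l 2 0) //.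
  by rewrite leq_pmulr // expn_gt0 prime_gt0.
have srch := allP (allP searches_succeed _ S_set) _ Pb_in.
rewrite eq_bin1 nat_of_bin_mod prod_binE S1 in srch.
rewrite modn_small ?prime_gt1 // eqxx in srch.
have : tabulated Pb (pow2 alpha) (B alpha).
  by apply: (search_complete (k := 0) cong1 srch).
case/hasP=> e e_in /and3P[/eqP prod_e /eqP pow_e /eqP P_e].
have alpha_e : e.1.2 = alpha.
  by apply/eqP; rewrite -(@eqn_exp2l 2) // -!pow2E pow_e.
split.
  rewrite LE carmichael_list_entries; apply/mapP; exists e => //.
  by rewrite -prod_binE prod_e B_prod alpha_e P_e.
rewrite PE -P_e.
have : all (fun e => (e.2 == 5%num) || (e.2 == 3%num)) entries by [].
by move/allP/(_ _ e_in)/orP => [] /eqP ->; [left | right].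
Qed.
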